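(* For each of the series $P_l=A_l$ ($l\ge1$), $P_l=B_l$ ($l\ge2$), $P_l=D_l$ ($l\ge4$), the smallest zero of $N_{G^{dual +}_{P_l}}(t)$ is monotonically decreasing in $l$ and converges to $0$ as $l\to\infty$.
   Context: For a finite Coxeter type $P$ with Coxeter system $(W,S)$, set of reflections $T$, reflection length $\ell_T$, order $g\le_T h\iff \ell_T(g)+\ell_T(g^{-1}h)=\ell_T(h)$, and bipartite Coxeter element $c$, the dual Artin monoid $G^{dual+}_P$ is the monoid generated by $T$ with relations $r\cdot s=(rsr^{-1})\cdot r$ for all $r,s\in T$ with $rs\le_T c$; it is graded by word length $\deg$ and is a lattice for left divisibility. Its skew-growth function is $N_{G^{dual+}_P}(t)=\sum_{J\subseteq T}(-1)^{|J|}t^{\deg(\mathrm{lcm}(J))}$. It is known that $N_{G^{dual +}_{A_l}}(t)=\sum_{k=0}^{l} (-1)^{k}\frac{1}{l}\binom {l}{k}\binom {l+k}{k+1}t^k$, $N_{G^{dual +}_{B_l}}(t)=\sum_{k=0}^{l} (-1)^{k}\binom {l}{k}\binom {l+k-1}{k}t^k$, $N_{G^{dual +}_{D_l}}(t)=\sum_{k=0}^{l} (-1)^{k} \big( \binom {l}{k}\binom {l+k-2}{k} + \binom {l-2}{k-2}\binom {l+k-3}{k}\big) t^k$; all their zeros are real. *)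

(* Defs.v *)
From HB Require Import structures.
From mathcomp Require Import all_boot all_order all_fingroup all_algebra.
From mathcomp Require Import all_classical all_reals all_analysis.

Set Implicit Arguments.
Unset Strict Implicit.
Unset Printing Implicit Defensive.

Import Order.TTheory GRing.Theory Num.Theory.
Import numFieldNormedType.Exports.

Section DualArtinMonoid.
Local Open Scope group_scope.

Variables (gT : finGroupType) (l : nat).
(* [s] enumerates the simple reflections of a Coxeter system [(<<S>>, S)]
   realized inside [gT]; [color] is a 2-colouring of its Coxeter graph. *)
Variables (s : 'I_l -> gT) (color : pred 'I_l).

Definition simple_refl : {set gT} := [set s i | i : 'I_l].

Definition coxeter_group : {set gT} := <<simple_refl>>.

Definition reflections : {set gT} := class_support simple_refl coxeter_group.

(* [reflections ^+ k] is the set of products of [k] reflections.  A shortest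
   factorization of an element of [coxeter_group] has fewer than [#|gT|]
   factors, its partial products being pairwise distinct. *)
Definition refl_length (g : gT) : nat :=
  find (fun k => g \in reflections ^+ k) (iota 0 #|gT|).

Definition abs_le (g h : gT) : bool :=
  refl_length g + refl_length (g^-1 * h) == refl_length h.

(* Generators of the same colour commute, so the enumeration order inside each
   of the two products is irrelevant. *)
Definition bipartite_coxeter_elt : gT :=
  (\prod_(i < l | ~~ color i) s i) * (\prod_(i < l | color i) s i).

Definition refl_type : Type := {t : gT | t \in reflections}.

(* The elements of the dual Artin monoid are the words on the reflections up to
   the congruence [dual_eq]; its product is concatenation. *)
Inductive dual_eq : seq refl_type -> seq refl_type -> Prop :=
| dual_eq_rel (r t r' : refl_type) of
    abs_le (val r * val t) bipartite_coxeter_elt &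
    val r' = val r * val t * (val r)^-1 :
    dual_eq [:: r; t] [:: r'; r]
| dual_eq_refl u : dual_eq u u
| dual_eq_sym u v of dual_eq u v : dual_eq v u
| dual_eq_trans u v w of dual_eq u v & dual_eq v w : dual_eq u w
| dual_eq_cat u u' v v' of dual_eq u u' & dual_eq v v' :
    dual_eq (u ++ v) (u' ++ v').

Definition left_dvd (u v : seq refl_type) : Prop :=
  exists w, dual_eq v (u ++ w).

Definition common_multiple (J : {set refl_type}) (m : seq refl_type) : Prop :=
  forall t, t \in J -> left_dvd [:: t] m.

Definition is_lcm (J : {set refl_type}) (m : seq refl_type) : Prop :=
  common_multiple J m /\ forall n, common_multiple J n -> left_dvd m n.

Lemma dual_eq_size u v : dual_eq u v -> size u = size v.
Proof.
by elim=> // [? ? ? _ -> _ -> //|? ? ? ? _ Hu _ Hv]; rewrite !size_cat Hu Hv.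
Qed.

Lemma left_dvd_size u v : left_dvd u v -> size u <= size v.
Proof. by case=> w /dual_eq_size ->; rewrite size_cat leq_addr. Qed.

Lemma is_lcm_size J m n : is_lcm J m -> is_lcm J n -> size m = size n.
Proof.
move=> [cm lm] [cn ln]; apply/eqP; rewrite eqn_leq.
by rewrite !left_dvd_size //; [apply: ln | apply: lm].
Qed.

(* The degree of [lcm J]; by [is_lcm_size] it does not depend on the word that
   represents the lcm.  The default value 0 is never used in a lattice. *)
Definition deg_lcm (J : {set refl_type}) : nat :=
  xget 0 [set d | exists2 m, is_lcm J m & size m = d]%classic.

Local Open Scope ring_scope.

Definition skew_growth (R : nzRingType) : {poly R} :=
  \sum_(J : {set refl_type}) (-1) ^+ #|J| *: 'X^(deg_lcm J).

End DualArtinMonoid.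

Section ClassicalSeries.
Local Open Scope group_scope.
Variable l : nat.

(* A_l: the symmetric group on l + 1 letters, with adjacent transpositions. *)
Definition simpleA (i : 'I_l) : {perm 'I_l.+1} :=
  tperm (widen_ord (leqnSn l) i) (lift ord0 i).

(* B_l and D_l act on the vectors e_i = (i, true) and - e_i = (i, false). *)

(* reflection orthogonal to e_i - e_j *)
Definition swap_refl (i j : 'I_l) : {perm 'I_l * bool} :=
  tperm (i, true) (j, true) * tperm (i, false) (j, false).

(* reflection orthogonal to e_i + e_j *)
Definition neg_swap_refl (i j : 'I_l) : {perm 'I_l * bool} :=
  tperm (i, true) (j, false) * tperm (i, false) (j, true).

(* reflection orthogonal to e_i *)
Definition flip_refl (i : 'I_l) : {perm 'I_l * bool} :=
  tperm (i, true) (i, false).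

(* simple roots e_i - e_(i+1) for i < l - 1, and e_(l-1) *)
Definition simpleB (i : 'I_l) : {perm 'I_l * bool} :=
  if i.+1 == l then flip_refl i else swap_refl i (ordS i).

(* simple roots e_i - e_(i+1) for i < l - 1, and e_(l-2) + e_(l-1) *)
Definition simpleD (i : 'I_l) : {perm 'I_l * bool} :=
  if i.+1 == l then neg_swap_refl (ord_pred i) i else swap_refl i (ordS i).

Definition path_color (i : 'I_l) : bool := odd i.

(* In D_l the nodes l - 2 and l - 1 are the two leaves attached to the node
   l - 3, so they have the same colour. *)
Definition fork_color (i : 'I_l) : bool :=
  odd (if i.+1 == l then i.-1 else i).

Definition skew_growthA (R : nzRingType) : {poly R} :=
  skew_growth simpleA path_color R.

Definition skew_growthB (R : nzRingType) : {poly R} :=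
  skew_growth simpleB path_color R.

Definition skew_growthD (R : nzRingType) : {poly R} :=
  skew_growth simpleD fork_color R.

End ClassicalSeries.

Section Zeros.
Local Open Scope ring_scope.
Local Open Scope classical_set_scope.
Variable R : realType.

Definition is_smallest_zero (p : {poly R}) (x : R) : Prop :=
  root p x /\ forall y, root p y -> x <= y.

(* [N] is only looked at for indices [l >= l0]. *)
Definition smallest_zero_decreases_to_0 (l0 : nat) (N : nat -> {poly R}) :=
  exists nu : nat -> R,
    [/\ forall l, (l0 <= l)%N -> is_smallest_zero (N l) (nu l),
        forall l m, (l0 <= l)%N -> (l < m)%N -> nu m < nu l
      & nu l @[l --> \oo] --> (0 : R)].

End Zeros.

(* Main.v *)
(* The polynomials [A_l] and [B_l] are multiples of Jacobi polynomials
   [P_l^(alpha, -1)(1 - 2t)] with [alpha = 1, 0], normalized to the value 1 at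
   [0], and satisfy
     r_l (p_(l+1) - p_l) = g_l (p_l - p_(l-1)) - w_l t p_l.
   Hence, for [l >= 2], [p_(l+1)] is negative at the smallest zero of [p_l],
   which gives the monotonicity; moreover [p_(l+1) <= (1 - (l+1) t) p_l] as long as
   [p_1, ..., p_l] are positive at [t >= 0], so the smallest zero of [p_l] is at
   most [1/l].  For type D,
     (2l-1) D_l = (l-2) B_l + (l+1 - (2l-1) t) B_(l-1),
   which places the smallest zero of [D_l] strictly between those of [B_l] and
   [B_(l-1)]. *)

Require Import Defs.
From HB Require Import structures.
From mathcomp Require Import all_boot all_order all_fingroup all_algebra.
From mathcomp Require Import all_classical all_reals all_analysis.
From mathcomp Require Import polyrcf ring lra zify.

Set Implicit Arguments.
Unset Strict Implicit.
Unset Printing Implicit Defensive.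

Import Order.TTheory GRing.Theory Num.Theory.
Import numFieldNormedType.Exports.

Local Open Scope ring_scope.

(** * Smallest real zeros of polynomials and their limit *)

Lemma smallest_zero_exists (R : realType) (p : {poly R}) (x : R) :
  p != 0 -> root p x -> exists nu, is_smallest_zero p nu.
Proof.
move=> p_neq0 px.
have mem_roots y : (y \in rootsR p) = root p y.
  by have := roots_on_rootsR p_neq0 y; rewrite in_itv.
have : sorted <=%R (rootsR p).
  by apply: (sub_sorted _ (sorted_roots _ _ p)) => y z /ltW.
case def_s: (rootsR p) => [|nu s] /= s_sorted.
  by move: px; rewrite -mem_roots def_s.
exists nu; split=> [|y]; rewrite -mem_roots def_s ?mem_head // inE.
by move=> /predU1P[-> // | ys]; apply: (allP (order_path_min le_trans s_sorted)).
Qed.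

(** A value [p.[t] <= 0] would, by the intermediate value theorem between [a] and [t], produce a
    zero below [nu]. *)
Lemma gt0_lt_smallest_zero (R : realType) (p : {poly R}) (a nu t : R) :
  is_smallest_zero p nu -> a < nu -> 0 < p.[a] -> t < nu -> 0 < p.[t].
Proof.
move=> [_ nu_min] a_lt pa_gt0 t_lt; rewrite ltNge; apply/negP => pt_le0.
have [le_at|/ltW le_ta] := leP a t.
- have [|x] := @poly_ivt _ (- p) _ _ le_at.
    by rewrite !hornerN oppr_le0 oppr_ge0 pt_le0 ltW.
  rewrite rootN => /andP[_ xt] /nu_min/le_trans/(_ xt).
  by rewrite leNgt t_lt.
- have [|x] := @poly_ivt _ p _ _ le_ta; first by rewrite pt_le0 ltW.
  move=> /andP[_ xa] /nu_min/le_trans/(_ xa).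
  by rewrite leNgt a_lt.
Qed.

Lemma smallest_zero_lt (R : realType) (p : {poly R}) (a b : R) :
  a <= b -> 0 < p.[a] -> p.[b] < 0 ->
  exists2 nu, is_smallest_zero p nu & nu < b.
Proof.
move=> le_ab pa pb.
have [|x] := @poly_ivtoo _ p _ _ le_ab; first by rewrite pmulr_rlt0.
rewrite in_itv /= => /andP[_ xb] px.
have [|nu nuP] := smallest_zero_exists (p := p) _ px.
  by apply: contraTneq pb => ->; rewrite horner0 ltxx.
by exists nu => //; apply: le_lt_trans xb; apply: nuP.2.
Qed.

Lemma smallest_zero_unique (R : realType) (p : {poly R}) (x y : R) :
  is_smallest_zero p x -> is_smallest_zero p y -> x = y.
Proof.
by move=> [px x_min] [py y_min]; apply/eqP; rewrite eq_le x_min // y_min.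
Qed.

(** The bound at index [l.+2] is only 1/(l+1) because this is what type D yields, where zeros are
    compared with those of type B one index lower. *)
Lemma decreases_to_0_of_steps (R : realType) (l0 : nat) (N : nat -> {poly R}) :
  (forall l, (l0 <= l)%N -> exists nu nu', [/\ is_smallest_zero (N l) nu,
     is_smallest_zero (N l.+1) nu', nu' < nu & 0 <= nu]) ->
  (forall l nu, (l0 <= l.+2)%N -> is_smallest_zero (N l.+2) nu ->
     nu <= l.+1%:R^-1) ->
  smallest_zero_decreases_to_0 l0 N.
Proof.
move=> step bound.
have ex_nu l : exists x, (l0 <= l)%N -> is_smallest_zero (N l) x.
  case: (leqP l0 l) => [/step[x [_ [xP _ _ _]]]|_]; first by exists x.
  by exists 0.
have [nu nuP] := boolp.choice ex_nu.
have nuS l : (l0 <= l)%N -> nu l.+1 < nu l /\ 0 <= nu l.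
  move=> l0l; have [x [y [xP yP lt_yx x_ge0]]] := step l l0l.
  rewrite (smallest_zero_unique (nuP l l0l) xP).
  by rewrite (smallest_zero_unique (nuP l.+1 (leqW l0l)) yP).
exists nu; split=> //.
  move=> l m l0l; elim: m => // m IHm.
  rewrite ltnS leq_eqVlt => /predU1P[<-|lm]; first by have [] := nuS l l0l.
  have [lt_m _] := nuS m (leq_trans l0l (ltnW lm)).
  exact: lt_trans lt_m (IHm lm).
(* The shift by 2 turns the bound into [harmonic], whose n-th term is 1/(n+1). *)
rewrite -(cvg_shiftn 2) /=.
apply: (@squeeze_cvgr _ _ _ _ (fun=> 0) (@harmonic R)); [|exact: cvg_cst|exact: cvg_harmonic].
exists l0 => // n /= l0n; have l0n2 : (l0 <= n.+2)%N by lia.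
rewrite addn2; have [_ ->] := nuS _ l0n2.
by apply: bound => //; apply: nuP.
Qed.

(** * Zeros of polynomials satisfying a Jacobi recurrence *)

(* The recurrence of the Jacobi polynomials [P_l^(alpha, -1)], normalized to
   the value 1 at [0], in the variable [1 - 2t].  The value [p 0] is
   irrelevant since [g 1 = 0]. *)
Record jacobi_rec (R : realType) (r g w : nat -> R) (p : nat -> {poly R}) : Prop :=
  JacobiRec {
    jacobi1 : p 1%N = 1 - 'X;
    jacobiS : forall l, (0 < l)%N ->
      r l *: (p l.+1 - p l) = g l *: (p l - p l.-1) - w l *: ('X * p l);
    jacobi_r_gt0 : forall l, (0 < l)%N -> 0 < r l;
    jacobi_g1 : g 1%N = 0;
    jacobi_g_gt0 : forall l, (1 < l)%N -> 0 < g l;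
    jacobi_w_ge : forall l, (0 < l)%N -> l.+1%:R * r l - l%:R * g l <= w l;
    jacobi_w_ge0 : forall l, (0 < l)%N -> 0 <= w l
  }.

Section JacobiRecurrence.
Variables (R : realType) (r g w : nat -> R) (p : nat -> {poly R}).
Hypothesis pP : jacobi_rec r g w p.

Lemma horner_jacobi1 t : (p 1).[t] = 1 - t.
Proof. by rewrite (jacobi1 pP) !hornerE. Qed.

Lemma horner_jacobiS l t : (0 < l)%N ->
  r l * ((p l.+1).[t] - (p l).[t]) =
  g l * ((p l).[t] - (p l.-1).[t]) - w l * t * (p l).[t].
Proof.
by move=> l_gt0; have := congr1 (horner^~ t) (jacobiS pP l_gt0); rewrite !hornerE.
Qed.

(** For [t <= 0] the term [- w l * t * p l] is nonnegative as long as [p l] is, so the increments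
    stay nonnegative, starting from p_1 = 1 - t >= 1. *)
Lemma jacobi_ge1 l t : (0 < l)%N -> t <= 0 -> 1 <= (p l).[t].
Proof.
move=> l_gt0 t_le0; suff : 1 <= (p l).[t] /\ (p l).[t] <= (p l.+1).[t] by case.
have step m : (0 < m)%N -> 1 <= (p m).[t] ->
    0 <= g m * ((p m).[t] - (p m.-1).[t]) -> (p m).[t] <= (p m.+1).[t].
  move=> m_gt0 pm_ge1 gm; rewrite -subr_ge0 -(pmulr_rge0 _ (jacobi_r_gt0 pP m_gt0)).
  rewrite horner_jacobiS // addr_ge0 // oppr_ge0 mulr_le0_ge0 //; last lra.
  exact: mulr_ge0_le0 (jacobi_w_ge0 pP m_gt0) _.
case: l l_gt0 => // l _; elim: l => [|l [pl_ge1 pl_le]].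
  have p1_ge1 : 1 <= (p 1).[t] by rewrite horner_jacobi1; lra.
  by split=> //; apply: step => //; rewrite (jacobi_g1 pP) mul0r.
have pl1_ge1 := le_trans pl_ge1 pl_le; split=> //; apply: step => //=.
by rewrite mulr_ge0 ?subr_ge0 // ltW // (jacobi_g_gt0 pP).
Qed.

Lemma jacobi_smallest_zero_gt0 l nu : (0 < l)%N ->
  is_smallest_zero (p l) nu -> 0 < nu.
Proof.
move=> l_gt0 [/eqP p_nu _]; rewrite ltNge; apply/negP => /(jacobi_ge1 l_gt0).
by rewrite p_nu ler10.
Qed.

Lemma jacobi_gt0 l nu t : (0 < l)%N -> is_smallest_zero (p l) nu -> t < nu ->
  0 < (p l).[t].
Proof.
move=> l_gt0 nuP; apply: (gt0_lt_smallest_zero nuP).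
  exact: jacobi_smallest_zero_gt0 nuP.
exact: lt_le_trans (jacobi_ge1 _ _).
Qed.

(* At the smallest zero of [p l] the recurrence reads
   [r p_(l+1) = - g p_(l-1)], and [p_(l-1)] is still positive there. *)
Lemma jacobi_smallest_zero_step l : (0 < l)%N -> exists nu nu',
  [/\ is_smallest_zero (p l) nu, is_smallest_zero (p l.+1) nu', nu' < nu
    & (1 < l)%N -> (p l.+1).[nu] < 0].
Proof.
have zero1 : is_smallest_zero (p 1) 1.
  split=> [|y]; first by rewrite /root horner_jacobi1 subrr.
  by rewrite /root horner_jacobi1 subr_eq0 => /eqP ->.
case: l => // l _; elim: l => [|l [nu [nu' [nuP nu'P lt_nu _]]]].
  have r1 : 0 < r 1 by rewrite (jacobi_r_gt0 pP).
  have w1 : 2 * r 1 <= w 1.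
    by have := jacobi_w_ge pP (ltn0Sn 0); rewrite (jacobi_g1 pP) mulr0 subr0.
  have w1_gt0 : 0 < w 1 by lra.
  (* Since [g 1 = 0], p_2 = (1 - (w_1 / r_1) t) p_1; the root of the first factor is at most 1/2. *)
  have p2 : root (p 2) (r 1 / w 1).
    have := horner_jacobiS (r 1 / w 1) (ltn0Sn 0); rewrite (jacobi_g1 pP) mul0r sub0r.
    rewrite mulrCA divff ?gt_eqF // mulr1 mulrBr => H; apply/eqP/(mulfI (lt0r_neq0 r1)).
    lra.
  have p2_neq0 : p 2 != 0.
    apply: contraTneq (@jacobi_ge1 2%N 0 isT (lexx _)) => ->.
    by rewrite horner0 ler10.
  have [nu nuP] := smallest_zero_exists p2_neq0 p2.
  (* The sign clause is vacuous here: p_1 divides p_2, so p_2 vanishes at 1 instead of being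
     negative. *)
  exists 1, nu; split=> //; apply: le_lt_trans (nuP.2 _ p2) _.
  by rewrite ltr_pdivrMr // mul1r; lra.
have r_gt0 : 0 < r l.+2 by rewrite (jacobi_r_gt0 pP).
have p_lt0 : (p l.+3).[nu'] < 0.
  rewrite -(pmulr_rlt0 _ r_gt0).
  have := horner_jacobiS nu' (ltn0Sn l.+1); rewrite (eqP nu'P.1) /= mulr0 !subr0 sub0r => ->.
  rewrite mulrN oppr_lt0 mulr_gt0 ?(jacobi_g_gt0 pP) //.
  exact: jacobi_gt0 nuP lt_nu.
have nu'_gt0 : 0 < nu' by apply: jacobi_smallest_zero_gt0 nu'P.
have [|nu'' nu''P lt_nu''] := smallest_zero_lt (ltW nu'_gt0) _ p_lt0.
  exact: lt_le_trans (jacobi_ge1 _ _).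
by exists nu', nu''; split.
Qed.

(** By induction: p_l <= (1 - l t) p_(l-1) forces p_l <= p_(l-1), hence p_l - p_(l-1) <= - l t p_l.
    The recurrence then gives r_l (p_(l+1) - p_l) <= - (l g_l + w_l) t p_l, and [jacobi_w_ge] says l
    g_l + w_l >= (l+1) r_l. *)
Lemma jacobi_contract l t : (0 < l)%N -> 0 <= t ->
  (forall j, (0 < j <= l)%N -> 0 < (p j).[t]) ->
  (p l.+1).[t] <= (1 - l.+1%:R * t) * (p l).[t].
Proof.
move=> + t_ge0; case: l => // l _; elim: l => [|l IHl] p_gt0.
  have r1 : 0 < r 1 by rewrite (jacobi_r_gt0 pP).
  have w1 : 2 * r 1 <= w 1.
    by have := jacobi_w_ge pP (ltn0Sn 0); rewrite (jacobi_g1 pP) mulr0 subr0.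
  have p1_gt0 := p_gt0 1%N isT.
  rewrite -subr_le0 -(pmulr_rle0 _ r1).
  have := horner_jacobiS t (ltn0Sn 0); rewrite (jacobi_g1 pP) mul0r sub0r => H.
  have := mulr_ge0 (mulr_ge0 (_ : 0 <= w 1 - 2 * r 1) t_ge0) (ltW p1_gt0).
  by rewrite subr_ge0 => /(_ w1); lra.
have {IHl} : (p l.+2).[t] <= (1 - l.+2%:R * t) * (p l.+1).[t].
  by apply: IHl => j /andP[j_gt0 /leqW jl]; rewrite p_gt0 // j_gt0.
have := p_gt0 l.+1 (leqnSn _); have := p_gt0 l.+2 (leqnn _).
set x := (p l.+2).[t]; set y := (p l.+1).[t] => x_gt0 y_gt0 le_xy.
have r_gt0 : 0 < r l.+2 by rewrite (jacobi_r_gt0 pP).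
have g_gt0 : 0 < g l.+2 by rewrite (jacobi_g_gt0 pP).
have m_ge0 : 0 <= l.+2%:R * t by rewrite mulr_ge0.
have le_yx : x <= y by have := mulr_ge0 m_ge0 (ltW y_gt0); lra.
have le_d : x - y <= - (l.+2%:R * t * x).
  by have := ler_wpM2l m_ge0 le_yx; lra.
have tx_ge0 : 0 <= t * x by rewrite mulr_ge0 // ltW.
rewrite -subr_le0 -(pmulr_rle0 _ r_gt0).
have := ler_wpM2r tx_ge0 (jacobi_w_ge pP (ltn0Sn l.+1)).
have := ler_wpM2l (ltW g_gt0) le_d.
have := horner_jacobiS t (ltn0Sn l.+1); rewrite /= -/x -/y.
lra.
Qed.

(** If [nu] exceeded 1/l, then p_1, ..., p_l would all be positive at 1/l, their smallest zeros
    being decreasing ([dec]); but there the factor 1 - l t of [jacobi_contract] vanishes, so p_l <=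
    0. *)
Lemma jacobi_smallest_zero_le l nu : (1 < l)%N -> is_smallest_zero (p l) nu ->
  nu <= l%:R^-1.
Proof.
have dec k : (0 < k)%N -> forall j x y, (0 < j <= k)%N ->
    is_smallest_zero (p k) x -> is_smallest_zero (p j) y -> x <= y.
  case: k => // k _; elim: k => [|k IHk] j x y.
    by case: j => [|[|]] // _ xP yP; rewrite (smallest_zero_unique xP yP).
  rewrite [(j <= _)%N]leq_eqVlt ltnS => /andP[j_gt0 /predU1P[->|jk]] xP yP.
    by rewrite (smallest_zero_unique xP yP).
  have [z [z' [zP z'P lt_z _]]] := jacobi_smallest_zero_step (ltn0Sn k).
  rewrite (smallest_zero_unique xP z'P); apply: le_trans (ltW lt_z) _.
  by apply: IHk zP yP; rewrite j_gt0.
case: l => [|[|l]] // _ nuP; rewrite leNgt; apply/negP => lt_nu.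
have t_ge0 : 0 <= l.+2%:R^-1 :> R by rewrite invr_ge0.
have pos j : (0 < j <= l.+2)%N -> 0 < (p j).[l.+2%:R^-1].
  move=> jl; have /andP[j_gt0 _] := jl.
  have [y [_ [yP _ _ _]]] := jacobi_smallest_zero_step j_gt0.
  apply: (jacobi_gt0 j_gt0 yP); apply: lt_le_trans lt_nu _.
  exact: dec jl nuP yP.
have := jacobi_contract (ltn0Sn l) t_ge0.
rewrite divff // subrr mul0r leNgt pos ?leqnn // => contract; apply/notF/contract.
by move=> j /andP[j_gt0 /leqW jl]; rewrite pos // j_gt0.
Qed.

Lemma jacobi_decreases_to_0 : smallest_zero_decreases_to_0 1 p.
Proof.
apply: decreases_to_0_of_steps => [l l_gt0|l nu _ nuP].
  have [x [y [xP yP lt_yx _]]] := jacobi_smallest_zero_step l_gt0.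
  by exists x, y; split=> //; rewrite ltW // (jacobi_smallest_zero_gt0 l_gt0 xP).
apply: le_trans (jacobi_smallest_zero_le _ nuP) _ => //.
by rewrite lef_pV2 ?posrE // ler_nat.
Qed.

End JacobiRecurrence.

(** * Coefficients in factorial form and their recurrences *)

(* The extension by 0 makes [invfact_subS] hold without side condition. *)
Definition invfact_sub (R : realType) (l k : nat) : R :=
  if (k <= l)%N then (l - k)`!%:R^-1 else 0.

Lemma invfact_subS (R : realType) (l k : nat) :
  invfact_sub R l k = (l.+1%:R - k%:R) * invfact_sub R l.+1 k.
Proof.
rewrite /invfact_sub; have [le_kl|lt_lk|->] := ltngtP k l.+1; last 2 first.
- by rewrite leqNgt ltnW // mulr0.
- by rewrite ltnn subrr mul0r.
rewrite -ltnS le_kl subSn // factS natrM invfM mulrA -natrB ?(ltnW le_kl) //.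
by rewrite subSn // divff ?mul1r.
Qed.

Lemma invfact_subSS (R : realType) (l k : nat) :
  invfact_sub R l.+1 k.+1 = invfact_sub R l k.
Proof. by rewrite /invfact_sub ltnS subSS. Qed.

Lemma natr_fact_neq0 (R : realType) (n : nat) : n`!%:R != 0 :> R.
Proof. by rewrite pnatr_eq0 -lt0n fact_gt0. Qed.

Lemma natr_bin (R : realType) (l k : nat) :
  'C(l, k)%:R = l`!%:R / k`!%:R * invfact_sub R l k :> R.
Proof.
rewrite /invfact_sub; case: leqP => [le_kl|lt_lk]; last by rewrite bin_small ?mulr0.
by rewrite -(bin_fact le_kl) !natrM; field; rewrite !natr_fact_neq0.
Qed.

Lemma natr_binD (R : realType) (k j : nat) :
  'C(k + j, k)%:R = (k + j)`!%:R / (k`!%:R * j`!%:R) :> R.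
Proof. by rewrite natr_bin /invfact_sub leq_addr addKn invfM mulrA. Qed.

Definition skew_coefA (R : realType) (l k : nat) : R :=
  l%:R^-1 * 'C(l, k)%:R * 'C(l + k, k.+1)%:R.

Definition skew_coefB (R : realType) (l k : nat) : R :=
  'C(l, k)%:R * 'C(l + k - 1, k)%:R.

(** The guard encodes the vanishing of binomials with negative lower index; truncated subtraction
    would give 'C(l - 2, 0) = 1 for k < 2. *)
Definition skew_coefD (R : realType) (l k : nat) : R :=
  'C(l, k)%:R * 'C(l + k - 2, k)%:R +
  (if (2 <= k)%N then 'C(l - 2, k - 2)%:R * 'C(l + k - 3, k)%:R else 0).

(** With [invfact_sub] isolated, all terms of an identity can be brought to one such factor, and
    [field] applies without cases on [k <= l]. *)
Lemma skew_coefA_fact (R : realType) (l k : nat) : skew_coefA R l.+1 k =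
  (k + l).+1`!%:R / (k`!%:R * k.+1`!%:R) * invfact_sub R l.+1 k.
Proof.
rewrite /skew_coefA (_ : l.+1 + k = k.+1 + l)%N; last by lia.
rewrite natr_bin natr_binD addSn factS natrM.
by field; rewrite !natr_fact_neq0 nat1r pnatr_eq0.
Qed.

(** The Jacobi recurrence at index [l.+1] in degree [k.+1], with the alternating signs removed. *)
Lemma skew_coefA_rec (R : realType) (l k : nat) :
  l.+3%:R * skew_coefA R l.+2 k.+1 =
  (2 * l.+1%:R + 1) * (skew_coefA R l.+1 k.+1 + 2 * skew_coefA R l.+1 k)
    - l%:R * skew_coefA R l k.+1.
Proof.
(* The factor [l%:R] covers [l = 0], outside the range of [skew_coefA_fact]. *)
have -> : l%:R * skew_coefA R l k.+1 = l%:R *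
    ((k + l).+1`!%:R / (k.+1`!%:R * k.+2`!%:R) * invfact_sub R l k.+1).
  by case: l => [|l]; rewrite ?mul0r // skew_coefA_fact addSnnS.
rewrite !skew_coefA_fact -(invfact_subSS _ _ k).
rewrite (invfact_subS _ l k.+1) (invfact_subS _ l.+1 k.+1).
rewrite addSn !addnS !factS !natrM.
by field; rewrite natr_fact_neq0 nat1r -natrD !pnatr_eq0.
Qed.

Lemma skew_coefB_fact (R : realType) (l k : nat) : skew_coefB R l.+1 k =
  l.+1%:R * (k + l)`!%:R / k`!%:R ^+ 2 * invfact_sub R l.+1 k.
Proof.
rewrite /skew_coefB (_ : l.+1 + k - 1 = k + l)%N; last by lia.
rewrite natr_bin natr_binD factS natrM.
by field; rewrite !natr_fact_neq0.
Qed.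

Lemma skew_coefB_factS (R : realType) (l k : nat) : skew_coefB R l k.+1 =
  l%:R * (k + l)`!%:R / k.+1`!%:R ^+ 2 * invfact_sub R l k.+1.
Proof.
case: l => [|l]; last by rewrite skew_coefB_fact addSnnS.
by rewrite /skew_coefB bin0n !mul0r.
Qed.

Lemma skew_coefB_rec (R : realType) (l k : nat) :
  l.+2%:R * (2 * l.+1%:R - 1) * skew_coefB R l.+2 k.+1 =
  (4 * l.+1%:R ^+ 2 - 2) * skew_coefB R l.+1 k.+1
  + 2 * (4 * l.+1%:R ^+ 2 - 1) * skew_coefB R l.+1 k
    - l%:R * (2 * l.+1%:R + 1) * skew_coefB R l k.+1.
Proof.
rewrite [skew_coefB R l _]skew_coefB_factS !skew_coefB_fact -(invfact_subSS _ _ k).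
rewrite (invfact_subS _ l k.+1) (invfact_subS _ l.+1 k.+1).
rewrite !addSn !addnS !factS !natrM.
by field; rewrite natr_fact_neq0 nat1r pnatr_eq0.
Qed.

(** The quotient k / k! stands for 1/(k-1)! and is 0 at [k = 0], in agreement with the guard of
    [skew_coefD]. *)
Lemma skew_coefD_fact (R : realType) (l k : nat) : skew_coefD R l.+3 k.+1 =
  (l.+3`!%:R / k.+1`!%:R * (l.+2 + k)`!%:R / (k.+1`!%:R * l.+1`!%:R)
   + l.+1`!%:R * k%:R / k`!%:R * (l.+1 + k)`!%:R / (k.+1`!%:R * l`!%:R))
  * invfact_sub R l.+3 k.+1.
Proof.
rewrite /skew_coefD mulrDl; congr (_ + _).
  rewrite (_ : l.+3 + k.+1 - 2 = k.+1 + l.+1)%N; last by lia.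
  rewrite natr_bin natr_binD (_ : k.+1 + l.+1 = l.+2 + k)%N; last by lia.
  by field; rewrite !natr_fact_neq0.
case: k => [|k] /=; first by rewrite mulr0 !mul0r.
rewrite (_ : l.+3 + k.+2 - 3 = k.+2 + l)%N; last by lia.
rewrite !subSS !subn0 natr_bin natr_binD (_ : k.+2 + l = l.+1 + k.+1)%N; last by lia.
rewrite 2!invfact_subSS [k.+1`!]factS natrM.
by field; rewrite !natr_fact_neq0 nat1r pnatr_eq0.
Qed.

(** The relation between types D and B at index [l.+3], whence 2 (l+3) - 1 = 2 l + 5; removing signs
    turns the last term positive. *)
Lemma skew_coefD_B (R : realType) (l k : nat) :
  (2 * l%:R + 5) * skew_coefD R l.+3 k.+1 =
  l.+1%:R * skew_coefB R l.+3 k.+1 + l.+4%:R * skew_coefB R l.+2 k.+1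
  + (2 * l%:R + 5) * skew_coefB R l.+2 k.
Proof.
rewrite skew_coefD_fact !skew_coefB_fact -(invfact_subSS _ _ k).
rewrite (invfact_subS _ l.+2 k.+1) [(l.+2 + k)%N]addnC [(l.+1 + k)%N]addnC.
rewrite !addSn !addnS !factS !natrM.
by field; rewrite !natr_fact_neq0 !nat1r !pnatr_eq0.
Qed.

(** * The polynomials of types A and B as Jacobi families *)

Definition alternating (R : realType) (c : nat -> nat -> R) (l : nat) : {poly R} :=
  \sum_(k < l.+1) ((-1) ^+ k * c l k) *: 'X^k.

Lemma coef_alternating (R : realType) (c : nat -> nat -> R) (l k : nat) :
  (forall k, (l < k)%N -> c l k = 0) ->
  (alternating c l)`_k = (-1) ^+ k * c l k.
Proof.
move=> c0; rewrite /alternating -(poly_def l.+1 (fun k => (-1) ^+ k * c l k)).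
by rewrite coef_poly ltnS; case: leqP => // /c0 ->; rewrite mulr0.
Qed.

Lemma coef_alternatingA (R : realType) (l k : nat) :
  (alternating (skew_coefA R) l)`_k = (-1) ^+ k * skew_coefA R l k.
Proof.
by apply: coef_alternating => j lj; rewrite /skew_coefA (bin_small lj) mulr0 mul0r.
Qed.

Lemma coef_alternatingB (R : realType) (l k : nat) :
  (alternating (skew_coefB R) l)`_k = (-1) ^+ k * skew_coefB R l k.
Proof.
by apply: coef_alternating => j lj; rewrite /skew_coefB (bin_small lj) mul0r.
Qed.

Lemma coef_alternatingD (R : realType) (l k : nat) : (1 < l)%N ->
  (alternating (skew_coefD R) l)`_k = (-1) ^+ k * skew_coefD R l k.
Proof.
move=> l_gt1; apply: coef_alternating => j lj; rewrite /skew_coefD (bin_small lj).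
by rewrite [X in X%:R * 'C(_ - 3, _)%:R]bin_small ?mul0r ?if_same ?addr0 //; lia.
Qed.

Lemma skew_coefA0 (R : realType) (l : nat) : skew_coefA R l.+1 0 = 1.
Proof. by rewrite /skew_coefA bin0 addn0 bin1 mulr1 mulVf ?pnatr_eq0. Qed.

Lemma skew_coefB0 (R : realType) (l : nat) : skew_coefB R l 0 = 1.
Proof. by rewrite /skew_coefB !bin0 mulr1. Qed.

(** Here [jacobi_w_ge] is an equality: (l+1)(l+2) - l(l-1) = 2(2l+1). *)
Lemma jacobi_rec_A (R : realType) : jacobi_rec (fun l => l%:R + 2)
  (fun l => l%:R - 1) (fun l => 2 * (2 * l%:R + 1)) (alternating (skew_coefA R)).
Proof.
split=> [|[//|l] _|l _||l l_gt1|l _|l _].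
- apply/polyP => -[|[|k]]; rewrite coef_alternatingA !coefE ?skew_coefA0 /=.
  + by rewrite subr0 mulr1.
  + by rewrite /skew_coefA bin1 binn invr1 expr1 !mulr1 sub0r.
  + by rewrite /skew_coefA bin_small // mulr0 mul0r mulr0 subr0.
- apply/polyP => -[|k]; rewrite !(coefZ, coefB, coefXM) /= !coef_alternatingA.
    rewrite !skew_coefA0 subrr !mulr0 subr0.
    (* The constant term of the polynomial of index 0 is 0, not 1, but its factor [g 1] is 0. *)
    by case: l => [|l]; rewrite ?skew_coefA0 subrr ?mulr0 // mul0r.
  have := congr1 (fun x => (-1) ^+ k * x) (skew_coefA_rec R l k); rewrite !exprS /=.
  set a := skew_coefA _ _ _; set b := skew_coefA _ _ _; set c := skew_coefA _ _ _.
  set d := skew_coefA _ _ _; set e := (-1) ^+ k.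
  lra.
- by rewrite ltr_wpDl.
- by rewrite subrr.
- by rewrite subr_gt0 ltr1n.
- by rewrite -natr1; lra.
- by rewrite mulr_ge0 // addr_ge0 // mulr_ge0.
Qed.

(** In [jacobi_w_ge] the left side is 4 l^2 + l - 1, below 8 l^2 - 2 for [l >= 1]. *)
Lemma jacobi_rec_B (R : realType) : jacobi_rec
  (fun l => (l%:R + 1) * (2 * l%:R - 1)) (fun l => (l%:R - 1) * (2 * l%:R + 1))
  (fun l => 2 * (4 * l%:R ^+ 2 - 1)) (alternating (skew_coefB R)).
Proof.
have natr_ge1 l : (0 < l)%N -> 1 <= l%:R :> R by rewrite ler1n.
split=> [|[//|l] _|l /natr_ge1 l_ge1||l l_gt1|l /natr_ge1 l_ge1|l /natr_ge1 l_ge1].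
- apply/polyP => -[|[|k]]; rewrite coef_alternatingB !coefE ?skew_coefB0 /=.
  + by rewrite subr0 mulr1.
  + by rewrite /skew_coefB !bin1 expr1 !mulr1 sub0r.
  + by rewrite /skew_coefB bin_small // mul0r mulr0 subr0.
- apply/polyP => -[|k]; rewrite !(coefZ, coefB, coefXM) /= !coef_alternatingB.
    by rewrite !skew_coefB0 subrr !mulr0 subr0.
  have := congr1 (fun x => (-1) ^+ k * x) (skew_coefB_rec R l k); rewrite !exprS /=.
  set a := skew_coefB _ _ _; set b := skew_coefB _ _ _; set c := skew_coefB _ _ _.
  set d := skew_coefB _ _ _; set e := (-1) ^+ k.
  lra.
- by rewrite mulr_gt0 //; lra.
- by rewrite subrr mul0r.
- by rewrite mulr_gt0 ?subr_gt0 ?ltr1n // ltr_wpDl // mulr_ge0.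
- by rewrite -natr1; nra.
- by nra.
Qed.

(** * Type D by comparison with type B *)

Lemma alternatingD (R : realType) (l : nat) :
  (2 * l%:R + 5) *: alternating (skew_coefD R) l.+3 =
  l.+1%:R *: alternating (skew_coefB R) l.+3
  + l.+4%:R *: alternating (skew_coefB R) l.+2
  - (2 * l%:R + 5) *: ('X * alternating (skew_coefB R) l.+2).
Proof.
apply/polyP => -[|k]; rewrite !(coefZ, coefB, coefD, coefXM) /=.
  rewrite coef_alternatingD // !coef_alternatingB !skew_coefB0 /skew_coefD /=.
  by rewrite !bin0; lra.
rewrite coef_alternatingD // !coef_alternatingB.
have := congr1 (fun x => (-1) ^+ k * x) (skew_coefD_B R l k); rewrite !exprS /=.
set a := skew_coefD _ _ _; set b := skew_coefB _ _ _; set c := skew_coefB _ _ _.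
set d := skew_coefB _ _ _; set e := (-1) ^+ k.
lra.
Qed.

(* For [t <= 1/2] the combination in [alternatingD] has positive weights, so
   [D_l] is positive wherever [B_l] and [B_(l-1)] are; at the smallest zero of
   [B_(l-1)] it has the sign of [B_l], which is negative. *)
Lemma smallest_zero_D_between (R : realType) (l : nat) : exists nu nu' nu'' : R,
  [/\ is_smallest_zero (alternating (skew_coefB R) l.+2) nu,
      is_smallest_zero (alternating (skew_coefD R) l.+3) nu',
      is_smallest_zero (alternating (skew_coefB R) l.+3) nu''
    & nu'' < nu' < nu].
Proof.
have recB := jacobi_rec_B R.
have [nu [nu'' [nuP nu''P lt_nu /(_ isT) B_lt0]]] :=
  jacobi_smallest_zero_step recB (ltn0Sn l.+1).
have valD t : (2 * l%:R + 5) * (alternating (skew_coefD R) l.+3).[t] =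
    l.+1%:R * (alternating (skew_coefB R) l.+3).[t]
    + (l.+4%:R - (2 * l%:R + 5) * t) * (alternating (skew_coefB R) l.+2).[t].
  by have := congr1 (horner^~ t) (alternatingD R l); rewrite !(hornerD, hornerN, hornerZ, hornerM, hornerX) => ->; ring.
have w_gt0 : 0 < 2 * l%:R + 5 :> R by rewrite ltr_wpDl // mulr_ge0.
have D_gt0 t : t <= nu'' -> 0 < (alternating (skew_coefD R) l.+3).[t].
  move=> le_t; rewrite -(pmulr_rgt0 _ w_gt0) valD.
  (* [nu''] is at most 1/(l+3); for t <= 1/2 the weight l + 4 - (2 l + 5) t is at least 3/2. *)
  have t_le : t <= 2^-1.
    apply: le_trans le_t (le_trans (jacobi_smallest_zero_le recB _ nu''P) _) => //.
    by rewrite lef_pV2 ?posrE // ler_nat.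
  have B_ge0 : 0 <= (alternating (skew_coefB R) l.+3).[t].
    move: le_t; rewrite le_eqVlt => /predU1P[->|lt_t]; first by rewrite (eqP nu''P.1).
    exact/ltW/(jacobi_gt0 recB _ nu''P lt_t).
  apply: ltr_wpDl; first by rewrite mulr_ge0.
  rewrite mulr_gt0 ?(jacobi_gt0 recB _ nuP (le_lt_trans le_t lt_nu)) //.
  have := ler_wpM2l (ltW w_gt0) t_le; lra.
have nu_gt0 := jacobi_smallest_zero_gt0 recB (ltn0Sn _) nuP.
have nu''_gt0 := jacobi_smallest_zero_gt0 recB (ltn0Sn _) nu''P.
have [||nu' nu'P lt_nu'] := @smallest_zero_lt _ (alternating (skew_coefD R) l.+3)
  0 nu (ltW nu_gt0).
- exact: D_gt0 (ltW _).
- by rewrite -(pmulr_rlt0 _ w_gt0) valD (eqP nuP.1) mulr0 addr0 pmulr_rlt0.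
exists nu, nu', nu''; split=> //; rewrite lt_nu' andbT ltNge.
by apply/negP => /D_gt0; rewrite (eqP nu'P.1) ltxx.
Qed.

Lemma eq_decreases_to_0 (R : realType) (l0 l1 : nat) (M N : nat -> {poly R}) :
  (l0 <= l1)%N -> (forall l, (l1 <= l)%N -> N l = M l) ->
  smallest_zero_decreases_to_0 l0 M -> smallest_zero_decreases_to_0 l1 N.
Proof.
move=> le01 NM [nu [nuP nu_lt nu_cvg]]; exists nu; split=> // l.
  by move=> l1l; rewrite NM //; apply/nuP/(leq_trans le01).
by move=> m l1l; apply/nu_lt/(leq_trans le01).
Qed.

(** The smallest zero of B_l separates those of D_(l+1) and D_l, and the one of B_(l-1) bounds that
    of D_l by 1/(l-1). *)
Lemma decreases_to_0_D (R : realType) :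
  smallest_zero_decreases_to_0 3 (alternating (skew_coefD R)).
Proof.
have recB := jacobi_rec_B R.
apply: decreases_to_0_of_steps => [[|[|[|l]]] //|[|l] nu //] _.
  have [_ [x [b [_ xP bP /andP[lt_bx _]]]]] := smallest_zero_D_between R l.
  have [b' [y [_ [b'P yP _ /andP[_ lt_yb]]]]] := smallest_zero_D_between R l.+1.
  have b_gt0 := jacobi_smallest_zero_gt0 recB (ltn0Sn _) bP.
  exists x, y; split=> //; last exact: ltW (lt_trans b_gt0 lt_bx).
  by rewrite (smallest_zero_unique b'P bP) in lt_yb; apply: lt_trans lt_yb lt_bx.
have [b [x [_ [bP xP _ /andP[_ /ltW le_xb]]]]] := smallest_zero_D_between R l.
move=> nuP; rewrite (smallest_zero_unique nuP xP).
exact: le_trans le_xb (jacobi_smallest_zero_le recB _ bP).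
Qed.

Theorem theorem6p1 (R : realType)
    (skew_growthA_formula : forall l : nat, (1 <= l)%N ->
       skew_growthA l R =
       \sum_(k < l.+1) ((-1) ^+ k * (l%:R^-1 * 'C(l, k)%:R * 'C(l + k, k.+1)%:R))
         *: 'X^k)
    (skew_growthB_formula : forall l : nat, (2 <= l)%N ->
       skew_growthB l R =
       \sum_(k < l.+1) ((-1) ^+ k * ('C(l, k)%:R * 'C(l + k - 1, k)%:R)) *: 'X^k)
    (skew_growthD_formula : forall l : nat, (4 <= l)%N ->
       skew_growthD l R =
       \sum_(k < l.+1) ((-1) ^+ k *
          ('C(l, k)%:R * 'C(l + k - 2, k)%:R +
           (if (2 <= k)%N then 'C(l - 2, k - 2)%:R * 'C(l + k - 3, k)%:R else 0)))
         *: 'X^k) :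
  [/\ smallest_zero_decreases_to_0 1 (fun l => skew_growthA l R),
      smallest_zero_decreases_to_0 2 (fun l => skew_growthB l R)
    & smallest_zero_decreases_to_0 4 (fun l => skew_growthD l R)].

Proof.
split.
- by apply: eq_decreases_to_0 (jacobi_decreases_to_0 (jacobi_rec_A R)).
- by apply: eq_decreases_to_0 (jacobi_decreases_to_0 (jacobi_rec_B R)).
- by apply: eq_decreases_to_0 (decreases_to_0_D R).
Qed.
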